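(* Let $r\ge 1$ and $k\ge 4$ be integers and let $G$ be an $(r,1,k;+1)$-graph, i.e. a $k$-geodetic mixed graph with minimum undirected degree $\ge r$, minimum directed out-degree $\ge 1$ and order $M(r,1,k)+1$. Then $G$ is totally regular.
   Context: A mixed graph $G$ consists of a finite set $V(G)$ of vertices, a set $E(G)$ of unordered pairs of vertices (edges, $u\sim v$) and a set $A(G)$ of ordered pairs (arcs, $u\to v$). There are no loops and no parallel edges or arcs, and $u\sim v$ and $u\to v$ cannot hold simultaneously. Mixed graphs are assumed proper: both $E(G)$ and $A(G)$ are non-empty. The undirected degree of $u$ is $d(u)=|\{v:u\sim v\}|$, the directed out-degree is $d^+(u)=|\{v:u\to v\}|$ and the directed in-degree is $d^-(u)=|\{v:v\to u\}|$. A mixed path of length $t$ is a walk $u_0u_1\dots u_t$ with $u_i\sim u_{i+1}$ or $u_i\to u_{i+1}$ for each $i$ that is non-backtracking, i.e. contains no sub-walk $u_i\sim u_{i+1}\sim u_i$ (length $0$ is allowed). $G$ is $k$-geodetic if for any ordered pair of (not necessarily distinct) vertices $u,v$ there is at most one mixed path from $u$ to $v$ of length $\le k$. The mixed Moore bound is \[ M(r,z,k)=A\frac{u_1^{k+1}-1}{u_1-1}+B\frac{u_2^{k+1}-1}{u_2-1},\] where $v=(z+r)^2+2(z-r)+1$, $u_1=\frac{z+r-1-\sqrt v}{2}$, $u_2=\frac{z+r-1+\sqrt v}{2}$, $A=\frac{\sqrt v-(z+r+1)}{2\sqrt v}$, $B=\frac{\sqrt v+(z+r+1)}{2\sqrt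 v}$ (this is the number of mixed paths of length $\le k$ starting at a vertex when all undirected degrees are $r$ and all directed out-degrees are $z$). $G$ is out-regular if $d(u)=d(v)$ and $d^+(u)=d^+(v)$ for all vertices $u,v$; it is totally regular if it is out-regular and $d^-(u)=d^+(u)$ for every vertex $u$. *)

(* Defs.v *)
From mathcomp Require Import all_boot all_order all_algebra.

Set Implicit Arguments.
Unset Strict Implicit.
Unset Printing Implicit Defensive.

Import Order.TTheory GRing.Theory Num.Theory.

(* Properness (existence of an edge and of an arc) is the separate predicate
   [proper_mixed]. *)
Record mixed_graph (V : finType) := MixedGraph {
  edge : rel V;
  arc : rel V;
  edge_sym : symmetric edge;
  edge_irr : irreflexive edge;
  arc_irr : irreflexive arc;
  edge_arc : forall u v, ~~ (edge u v && arc u v)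
}.

Section MixedGraph.
Variables (V : finType) (G : mixed_graph V).

Definition proper_mixed : Prop :=
  (exists u v, edge G u v) /\ (exists u v, arc G u v).

Definition udeg (u : V) : nat := #|[set v | edge G u v]|.
Definition outdeg (u : V) : nat := #|[set v | arc G u v]|.
Definition indeg (u : V) : nat := #|[set v | arc G v u]|.

Fixpoint nonbacktracking (s : seq V) : bool :=
  match s with
  | u :: ((v :: w :: _) as s') =>
      ~~ [&& edge G u v, edge G v w & w == u] && nonbacktracking s'
  | _ => true
  end.

(* The walk u = u_0 u_1 ... u_t is represented, as in path.v, by u and
   p = [:: u_1; ...; u_t]; its length is size p. An edge and an arc never join
   the same ordered pair, so the vertex sequence determines the walk. *)
Definition mixed_path (u : V) (p : seq V) : bool :=
  path (fun x y => edge G x y || arc G x y) u p && nonbacktracking (u :: p).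

Definition geodetic (k : nat) : Prop :=
  forall (u v : V) (p q : seq V),
    mixed_path u p -> last u p = v -> size p <= k ->
    mixed_path u q -> last u q = v -> size q <= k ->
    p = q.

Definition out_regular : Prop :=
  forall u v : V, udeg u = udeg v /\ outdeg u = outdeg v.

Definition totally_regular : Prop :=
  out_regular /\ (forall u : V, indeg u = outdeg u).

End MixedGraph.

Section MooreBound.
Local Open Scope ring_scope.

(* The divisors u1 - 1, u2 - 1 and 2 * sqrt v are all nonzero
   whenever r, z >= 1. *)
Definition moore_bound (R : rcfType) (r z k : nat) : R :=
  let s : R := z%:R + r%:R in
  let v : R := s ^+ 2 + 2%:R * (z%:R - r%:R) + 1 in
  let u1 : R := (s - 1 - Num.sqrt v) / 2%:R in
  let u2 : R := (s - 1 + Num.sqrt v) / 2%:R in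
  let A : R := (Num.sqrt v - (s + 1)) / (2%:R * Num.sqrt v) in
  let B : R := (Num.sqrt v + (s + 1)) / (2%:R * Num.sqrt v) in
  A * ((u1 ^+ k.+1 - 1) / (u1 - 1)) + B * ((u2 ^+ k.+1 - 1) / (u2 - 1)).

(* An (r, z, k; +eps)-graph. *)
Definition excess_graph (R : rcfType) (V : finType) (r z k eps : nat)
    (G : mixed_graph V) : Prop :=
  [/\ proper_mixed G,
      geodetic G k,
      forall u : V, (r <= udeg G u)%N,
      forall u : V, (z <= outdeg G u)%N
    & #|V|%:R = moore_bound R r z k + eps%:R].

End MooreBound.

(* Main.v *)
Require Import Defs.
From mathcomp Require Import all_boot all_order all_algebra.
From mathcomp Require Import ring lra zify.

(** Every vertex is the root of a tree of mixed paths of length at most [k];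
    by geodecity the end-points of these paths are distinct, and the degree
    bounds force at least [M(r,1,k)] of them, which is one less than the order.
    A larger degree at the root would produce too many paths, so the graph is
    out-regular ([degrees_eq]), and each vertex [u] misses at most one vertex
    ([unreached_eq]).

    The average in-degree is 1, so if some in-degree differs from 1, some vertex
    [v] has in-degree at least 2; this is refuted in [indeg_le1].  Three facts
    about missed vertices are used, each obtained by exhibiting two short paths
    with the same ends.  If [u] goes by an arc and then an edge to [x], then [u]
    misses every tail of an arc into [x] ([arc_edge_unreached]); as only one
    vertex can be missed, all undirected neighbours of [v] have in-degree 0
    ([nbr_indeg0]).  At most one tail of an arc into [x] is reached from [x]
    ([reached_in_arc_unique]); hence in-degrees are at most 2, and a vertex of
    in-degree 2 misses one of its arc-predecessors.  If [y] is the
    out-neighbour of [v], then [y] misses every undirected neighbour of [v] of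
    in-degree 0 ([source_unreached]).

    The last fact leaves [v] a single undirected neighbour [s], so [r = 1] and
    the edges form a perfect matching.  The in-degrees of two matched vertices
    add up to at most 2, so by averaging to exactly 2.  The partner of [y] has
    in-degree 0: a tail of an arc into it is missed by [v], hence is also a tail
    of an arc into [v], and out-degrees are 1.  So [y] has in-degree 2 and
    misses one of its own arc-predecessors, which must be [s].  Now [v] has an
    arc to [y] and also the path through [s], a contradiction. *)

Set Implicit Arguments.
Unset Strict Implicit.
Unset Printing Implicit Defensive.

Import Order.TTheory GRing.Theory Num.Theory.

(* The name [arc] also denotes sub-arcs of cycles in [path]. *)
Local Notation arc := Defs.arc.

(** * The Moore bound as the size of a tree of paths *)

(** The number of mixed paths of length at most [t] from a vertex, when all
    undirected degrees are [r] and all out-degrees are 1.  The flag tells that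
    the vertex was entered through an edge, which the path may not take back. *)
Fixpoint tree_size (r t : nat) (b : bool) : nat :=
  if t is t'.+1 then 1 + (r - b) * tree_size r t' true + tree_size r t' false
  else 1.

Lemma tree_size_gt0 r t b : 0 < tree_size r t b.
Proof. by case: t. Qed.

Lemma tree_size_gt1 r t b : 0 < t -> 1 < tree_size r t b.
Proof.
by case: t => //= t _; rewrite -addnA add1n ltnS addn_gt0 tree_size_gt0 orbT.
Qed.

(** The number of paths of length exactly [t] satisfies a recurrence with
    characteristic polynomial [x^2 - r x - 1] and first values [1] and
    [r + 1]; summing it over [t] adds the constant [1 + (r + 1) - r * 1]. *)
Lemma tree_size_rec r t : 0 < r ->
  tree_size r t.+2 false = r * tree_size r t.+1 false + tree_size r t false + 2.
Proof.
case: r => // r _ /=; rewrite !subn0 subn1 /=.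
by move: (tree_size _ _ _) (tree_size _ _ _) => x y; ring.
Qed.

Local Open Scope ring_scope.

(** For one arc per vertex, [u1] and [u2] are the roots of [x^2 - r x - 1], and
    [A] and [B] are fitted to the first two values.  So both sides satisfy
    [tree_size_rec]. *)
Lemma moore_bound_tree_size (R : rcfType) (r k : nat) : (0 < r)%N ->
  moore_bound R r 1 k = (tree_size r k false)%:R.
Proof.
move=> r_gt0; rewrite /moore_bound.
set a : R := r%:R.
have a_gt0 : 0 < a by rewrite ltr0n.
have -> : (1 + a) ^+ 2 + 2%:R * (1 - a) + 1 = a ^+ 2 + 4 by ring.
set q := Num.sqrt _.
have q2 : q ^+ 2 = a ^+ 2 + 4 by rewrite sqr_sqrtr; nra.
have q_gt0 : 0 < q by rewrite sqrtr_gt0; nra.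
have q_neq0 : q != 0 by rewrite gt_eqF.
set u1 := (1 + a - 1 - q) / 2; set u2 := (1 + a - 1 + q) / 2.
set A := _ / (2 * q); set B := _ / (2 * q).
have AB1 : A + B = 1 by rewrite /A /B; field.
have ABu : A * u1 + B * u2 = a + 1 by rewrite /A /B /u1 /u2; field.
have u1q : u1 ^+ 2 = a * u1 + 1 by rewrite /u1; nra.
have u2q : u2 ^+ 2 = a * u2 + 1 by rewrite /u2; nra.
pose g u j : R := (u ^+ j.+1 - 1) / (u - 1).
have gS u j : u - 1 != 0 -> g u j.+1 = 1 + u * g u j.
  by move=> u_neq1; rewrite /g exprS; field.
have g0 u : u - 1 != 0 -> g u 0 = 1 by move=> ?; rewrite /g expr1 divff.
have neq1 u : u ^+ 2 = a * u + 1 -> u - 1 != 0.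
  move=> uq; apply: contraTneq a_gt0 => /subr0_eq u1E.
  by rewrite -leNgt; move: uq; rewrite u1E expr1n mulr1; lra.
clearbody A B u1 u2.
have u1n := neq1 _ u1q; have u2n := neq1 _ u2q.
rewrite -/(g u1 k) -/(g u2 k).
suff [] : A * g u1 k + B * g u2 k = (tree_size r k false)%:R /\
          A * g u1 k.+1 + B * g u2 k.+1 = (tree_size r k.+1 false)%:R by [].
elim: k => [|k [IH0 IH1]].
  rewrite !gS // !g0 // /= subn0 !mulr1 AB1 muln1 !natrD -/a.
  by split=> //; lra.
split=> //; rewrite tree_size_rec // !natrD natrM -/a -IH0 -IH1.
rewrite !gS // -[2%:R]/(2 : R).
(* By [A + B = 1] and [A u1 + B u2 = a + 1]: splitting the constant of the
   recurrence lets each root be treated on its own. *)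
have -> : (2 : R) = A * (1 + u1 - a) + B * (1 + u2 - a).
  rewrite (_ : _ + _ = (A + B) * (1 - a) + (A * u1 + B * u2)); last by ring.
  by rewrite AB1 ABu; ring.
set x := g u1 k; set y := g u2 k.
suff : A * x * (u1 ^+ 2 - a * u1 - 1) + B * y * (u2 ^+ 2 - a * u2 - 1) = 0 by lra.
by rewrite u1q u2q; ring.
Qed.

Local Close Scope ring_scope.

Lemma sum_eq_upper_bound (I : finType) (F : I -> nat) (c : nat) :
  (forall i, F i <= c) -> \sum_i F i = \sum_(i : I) c -> forall i, F i = c.
Proof.
move=> Fc sumE i; have /leqif_sum := fun i (_ : xpredT i) => leqif_eq (Fc i).
by case=> _; rewrite sumE eqxx => /esym/forallP/(_ i)/eqP.
Qed.

(** * Trees of mixed paths *)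

Section Paths.
Variables (V : finType) (G : mixed_graph V).

Lemma nonbacktracking_behead u s :
  nonbacktracking G (u :: s) -> nonbacktracking G s.
Proof. by case: s => [|v [|w s]] //= /andP[]. Qed.

Lemma mixed_path_behead u c p : mixed_path G u (c :: p) -> mixed_path G c p.
Proof.
by case/andP=> + /nonbacktracking_behead nb => /= /andP[_ pP]; apply/andP.
Qed.

Lemma nonbacktracking_cons b u s :
  ~~ edge G b u -> nonbacktracking G (u :: s) -> nonbacktracking G (b :: u :: s).
Proof. by move=> /negbTE bu; case: s => [|w s] //= ->; rewrite bu. Qed.

Lemma arc_edgeF u v : arc G u v -> edge G u v = false.
Proof. by move=> uv; have := edge_arc G u v; rewrite uv andbT => /negbTE. Qed.

Lemma mixed_path_cons_arc u c p :
  arc G u c -> mixed_path G c p -> mixed_path G u (c :: p).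
Proof.
move=> uc /andP[pP nb]; apply/andP; split; first by rewrite /= uc orbT.
by apply: nonbacktracking_cons; rewrite // arc_edgeF.
Qed.

Lemma nonbacktracking_rcons a s x :
  arc G (last a s) x -> nonbacktracking G (a :: s) ->
  nonbacktracking G (a :: rcons s x).
Proof.
elim: s a => [|b s IH] a //= lx; case: s IH lx => [|c s] IH /= lx.
  by rewrite (arc_edgeF lx) /= andbF.
by case/andP=> -> /= nb; apply: IH.
Qed.

Lemma mixed_path_rcons_arc u p x :
  mixed_path G u p -> arc G (last u p) x -> mixed_path G u (rcons p x).
Proof.
case/andP=> pP nb lx; apply/andP; split; last exact: nonbacktracking_rcons.
by rewrite rcons_path pP lx orbT.
Qed.

Lemma nonbacktracking_rconsK s x :
  nonbacktracking G (rcons s x) -> nonbacktracking G s.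
Proof.
by elim: s => [|a [|b [|c s]] IH] //= /andP[-> nb]; apply: IH.
Qed.

Lemma mixed_path_rconsK u p x : mixed_path G u (rcons p x) -> mixed_path G u p.
Proof.
case/andP; rewrite rcons_path -rcons_cons => /andP[pP _].
by move=> /nonbacktracking_rconsK nb; apply/andP.
Qed.

(** The vertex [b] is the one visited just before [u].  At the root, where there
    is none, [b = u] is used: it forbids nothing, as there is no loop at [u]. *)
Definition children (b u : V) : {set V} :=
  [set c | edge G u c && ~~ (edge G b u && (c == b)) || arc G u c].

Fixpoint path_tree (t : nat) (b u : V) : seq (seq V) :=
  if t is t'.+1 then
    [::] :: [seq c :: p | c <- enum (children b u), p <- path_tree t' u c]
  else [:: [::]].

Lemma path_tree_path t b u p : p \in path_tree t b u ->
  [/\ path (fun x y => edge G x y || arc G x y) u p,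
      nonbacktracking G (b :: u :: p) & size p <= t].
Proof.
elim: t b u p => [|t IH] b u p /=; first by rewrite inE => /eqP->.
rewrite inE => /predU1P[-> //|/allpairsPdep[c [p' [cP /IH[pP nb szp] ->]]]].
move: cP; rewrite mem_enum inE => cP; split=> //.
  by rewrite /= pP andbT; case/orP: cP => [/andP[->]|->]; rewrite ?orbT.
apply/andP; split; last exact: nb.
case/orP: cP => [/andP[->]|uc]; first by rewrite andTb.
by rewrite (arc_edgeF uc) andbF.
Qed.

Lemma path_tree_uniq t b u : uniq (path_tree t b u).
Proof.
elim: t b u => [|t IH] b u //=; apply/andP; split.
  by apply/negP => /allpairsPdep[c [p []]].
apply: allpairs_uniq_dep; first exact: enum_uniq.
  by move=> c _; apply: IH.
by move=> [c p] [c' p'] _ _ /= [-> ->].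
Qed.

(** Lower bounds on the subtrees below edges and below arcs are kept separate
    from the degrees of the root, so that the lemma also measures how much a
    too large degree adds. *)
Lemma size_path_tree_ge (t x y : nat) (b u : V) :
  (forall c, edge G u c -> x <= size (path_tree t u c)) ->
  (forall c, arc G u c -> y <= size (path_tree t u c)) ->
  1 + (udeg G u - edge G b u) * x + outdeg G u * y
    <= size (path_tree t.+1 b u).
Proof.
move=> hx hy; rewrite /= size_allpairs_dep sumnE big_map big_enum /=.
rewrite -addnA add1n ltnS (bigID (fun c => edge G u c)) /=.
apply: leq_add.
  pose D := [set c | edge G u c] :\: [set c | edge G b u && (c == b)].
  apply: (@leq_trans (\sum_(c in D) x)).
    rewrite sum_nat_const leq_mul2r; apply/orP; right.
    rewrite cardsD /udeg; apply: leq_sub2l.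
    apply: leq_trans (subset_leq_card (subsetIr _ _)) _.
    case: (edge G b u) => /=; last by rewrite eq_card0 // => c; rewrite !inE.
    rewrite (_ : [set c | c == b] = [set b]) ?cards1 //.
    by apply/setP=> c; rewrite !inE.
  rewrite [leqRHS](eq_bigl (mem D)).
    by apply: leq_sum => c; rewrite !inE => /andP[_]; apply: hx.
  move=> c; rewrite !inE; case uc: (edge G u c); rewrite ?andbF //= ?andbT.
  by have := edge_arc G u c; rewrite uc /= => /negbTE ->; rewrite orbF.
rewrite /outdeg -sum_nat_const.
rewrite [leqRHS](eq_bigl (mem [set v | arc G u v])).
  by apply: leq_sum => c; rewrite !inE; apply: hy.
move=> c; rewrite !inE; case uc: (arc G u c); first by rewrite (arc_edgeF uc).
by rewrite orbF; case: (edge G u c); rewrite ?andbF.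
Qed.

Lemma tree_size_le (r t : nat) (b u : V) :
  (forall u, r <= udeg G u) -> (forall u, 1 <= outdeg G u) ->
  tree_size r t (edge G b u) <= size (path_tree t b u).
Proof.
move=> hr hz; elim: t b u => [|t IH] b u //=.
apply: leq_trans (size_path_tree_ge (x := tree_size r t true)
  (y := tree_size r t false) b _ _); last first.
- by move=> c uc; have := IH u c; rewrite (arc_edgeF uc).
- by move=> c uc; have := IH u c; rewrite uc.
rewrite leq_add ?leq_add2l ?leq_pmull // leq_mul2r leq_sub2r ?orbT //.
Qed.

Definition reach (k : nat) (u x : V) : bool :=
  x \in [seq last u p | p <- path_tree k u u].

Lemma reachP k u x : reach k u x ->
  exists p, [/\ mixed_path G u p, last u p = x & size p <= k].
Proof.
case/mapP=> p /path_tree_path[pP nb sz] ->; exists p; split=> //.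
by apply/andP; split=> //; apply: nonbacktracking_behead nb.
Qed.

Lemma endpoints_uniq k u :
  geodetic G k -> uniq [seq last u p | p <- path_tree k u u].
Proof.
move=> geo; rewrite map_inj_in_uniq ?path_tree_uniq // => p q.
move=> /path_tree_path[pP nbp szp] /path_tree_path[qP nbq szq] pq.
have mp s : path (fun x y => edge G x y || arc G x y) u s ->
    nonbacktracking G (u :: u :: s) -> mixed_path G u s.
  by move=> sP /nonbacktracking_behead nb; apply/andP.
by apply: (geo u (last u q)); rewrite // mp.
Qed.

(** The vertices [a] and [b], if distinct, would come in addition to the
    pairwise distinct end-points of the tree. *)
Lemma unreached_unique k u a b :
  geodetic G k -> #|V| <= (size (path_tree k u u)).+1 ->
  ~~ reach k u a -> ~~ reach k u b -> a = b.
Proof.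
move=> geo card na nb; apply/eqP; apply: contraT => ab.
pose s := [:: a, b & [seq last u p | p <- path_tree k u u]].
have /card_uniqP szE : uniq s.
  by rewrite /= inE negb_or ab na nb endpoints_uniq.
have := max_card (mem s); rewrite szE /=.
by rewrite size_map => le; have := leq_trans le card; rewrite ltnn.
Qed.

(** * Geodetic graphs of excess one *)

Section UnitExcess.
Variables (r k : nat).
Hypotheses (r_gt0 : 0 < r) (k_ge3 : 3 <= k) (geo : geodetic G k).
Hypotheses (udeg_ge : forall u, r <= udeg G u)
           (outdeg_ge : forall u, 1 <= outdeg G u).
Hypothesis (card_eq : #|V| = tree_size r k false + 1).

(** One more child of the root would add a whole subtree, of size at least 2,
    to a tree that may exceed the Moore bound by at most 1. *)
Lemma degrees_eq u : udeg G u = r /\ outdeg G u = 1.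
Proof.
have le : size (path_tree k u u) <= #|V|.
  rewrite -(size_map (last u)) -(card_uniqP (endpoints_uniq u geo)).
  exact: max_card.
case: k k_ge3 card_eq le => // k' k'_ge2 cE le.
have := @size_path_tree_ge k' (tree_size r k' true) (tree_size r k' false) u u.
rewrite edge_irr subn0 => /(_ _ _)/leq_trans/(_ le) {le}; rewrite cE /=.
have tt := @tree_size_gt1 r k' true (ltnW k'_ge2).
have tf := @tree_size_gt1 r k' false (ltnW k'_ge2).
move=> H; have: 1 + udeg G u * tree_size r k' true
    + outdeg G u * tree_size r k' false <=
  1 + (r - 0) * tree_size r k' true + tree_size r k' false + 1.
  apply: H => c uc; have := tree_size_le k' u c udeg_ge outdeg_ge.
  - by rewrite uc.
  - by rewrite (arc_edgeF uc).
have := udeg_ge u; have := outdeg_ge u.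
move: (udeg G u) (outdeg G u) (tree_size _ _ _) (tree_size _ _ _) tt tf => d o x y.
rewrite subn0 => x1 y1 o1 dr le; split; nia.
Qed.

Lemma unreached_eq u a b : ~~ reach k u a -> ~~ reach k u b -> a = b.
Proof.
apply: unreached_unique => //; rewrite card_eq addn1 ltnS.
by have := tree_size_le k u u udeg_ge outdeg_ge; rewrite edge_irr.
Qed.

Lemma arc_inj u a b : arc G u a -> arc G u b -> a = b.
Proof.
have [_ /eqP o1] := degrees_eq u; move: o1; rewrite eqn_leq => /andP[o1 _].
by move=> ua ub; apply: (card_le1_eqP o1); rewrite inE.
Qed.

Lemma ex_arc u : exists v, arc G u v.
Proof.
by have /card_gt0P[v] := outdeg_ge u; rewrite inE => uv; exists v.
Qed.

Lemma path_eq u p q : mixed_path G u p -> mixed_path G u q ->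
  size p <= k -> size q <= k -> last u p = last u q -> p = q.
Proof. by move=> mp mq sp sq lpq; apply: (geo mp lpq sp mq). Qed.

(** A path from [u] to [w] followed by the arc to [x] is a path whose second
    vertex [c] reaches [x] within [k] steps, arriving by an arc.  But [c] also
    reaches [x] arriving by the edge from [y]: directly if [c = y], and
    otherwise by going back through [u]. *)
Lemma arc_edge_unreached u y x w :
  arc G u y -> edge G y x -> arc G w x -> ~~ reach k u w.
Proof.
move=> uy yx wx; apply/negP => /reachP[p [mp lp sp]].
have yw : y <> w by move=> yw; move: yx; rewrite yw (arc_edgeF wx).
case: p => [|c p] in mp lp sp *.
  move: wx; rewrite -lp /= => ux; have yxE := arc_inj uy ux.
  by rewrite yxE edge_irr in yx.
have mq : mixed_path G c (rcons p x).
  apply: (@mixed_path_behead u); rewrite -rcons_cons.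
  by apply: mixed_path_rcons_arc; rewrite // lp.
have sq : size (rcons p x) <= k by rewrite size_rcons.
case/andP: mp => /= /andP[/orP[uc|uc] _] _.
- have cu : edge G c u by rewrite edge_sym.
  have mq' : mixed_path G c [:: u; y; x].
    by rewrite /mixed_path /= cu uy yx (arc_edgeF uy) !orbT.
  have := path_eq mq mq' sq k_ge3; rewrite last_rcons => /(_ erefl).
  rewrite -[RHS]/(rcons [:: u; y] x) => /rcons_inj[pE].
  by apply: yw; rewrite -lp pE.
- have cy := arc_inj uc uy; rewrite {}cy in uc mq lp *.
  have mq' : mixed_path G y [:: x] by rewrite /mixed_path /= yx.
  have := path_eq mq mq' sq (ltnW (ltnW k_ge3)); rewrite last_rcons => /(_ erefl).
  by rewrite -[RHS]/(rcons [::] x) => /rcons_inj[pE]; apply: yw; rewrite -lp pE.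
Qed.

(** A path from [v] to [w], closed up by the arc to [v], cannot start with an
    edge to some [c], because [c] already reaches [v] by that edge; so it starts
    with the arc to [y]. *)
Lemma reach_in_arc v y w : arc G v y -> arc G w v -> reach k v w ->
  exists p, [/\ mixed_path G y (rcons p v), size (rcons p v) <= k & last y p = w].
Proof.
move=> vy wv /reachP[[|c p] [mp /= lp sp]].
  by rewrite -lp arc_irr in wv.
have mq : mixed_path G c (rcons p v).
  apply: (@mixed_path_behead v); rewrite -rcons_cons.
  by apply: mixed_path_rcons_arc; rewrite //= lp.
have sq : size (rcons p v) <= k by rewrite size_rcons.
case/andP: mp => /= /andP[/orP[vc|vc] _] _; last first.
  by rewrite (arc_inj vy vc); exists p.
have cv : edge G c v by rewrite edge_sym.
have mq' : mixed_path G c [:: v] by rewrite /mixed_path /= cv.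
have := path_eq mq mq' sq (ltnW (ltnW k_ge3)); rewrite last_rcons => /(_ erefl).
rewrite -[RHS]/(rcons [::] v) => /rcons_inj[pE].
by move: lp; rewrite pE /= => cw; rewrite cw (arc_edgeF wv) in cv.
Qed.

Lemma reached_in_arc_unique v a b :
  arc G a v -> arc G b v -> reach k v a -> reach k v b -> a = b.
Proof.
move=> av bv ra rb; have [y vy] := ex_arc v.
have [p [mp sp <-]] := reach_in_arc vy av ra.
have [q [mq sq <-]] := reach_in_arc vy bv rb.
have := path_eq mp mq sp sq; rewrite !last_rcons => /(_ erefl).
by case/rcons_inj=> ->.
Qed.

Lemma indeg0P x : reflect (forall w, ~~ arc G w x) (indeg G x == 0).
Proof.
rewrite cards_eq0; apply: (iffP eqP) => [E w|na].
  by have := in_set0 w; rewrite -E inE => ->.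
by apply/setP => w; rewrite !inE (negbTE (na w)).
Qed.

Lemma indeg_le2 v : indeg G v <= 2.
Proof.
rewrite /indeg -(cardsID [set w | reach k v w]) -[2]/(1 + 1) leq_add //.
  apply/card_le1_eqP => a b; rewrite !inE => /andP[av ra] /andP[bv rb].
  exact: reached_in_arc_unique bv av rb ra.
apply/card_le1_eqP => a b; rewrite !inE => /andP[na _] /andP[nb _].
exact: unreached_eq nb na.
Qed.

Lemma unreached_in_arc v : 1 < indeg G v -> exists2 w, arc G w v & ~~ reach k v w.
Proof.
case/card_gt1P=> a [b []]; rewrite !inE => av bv /eqP ab.
have [ra|na] := boolP (reach k v a); last by exists a.
have [rb|nb] := boolP (reach k v b); last by exists b.
by case: ab; apply: reached_in_arc_unique av bv ra rb.
Qed.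

(** If [w] had an arc to [y], then all tails of arcs into [v] would be missed by
    [w]. *)
Lemma nbr_indeg0 v y : 1 < indeg G v -> edge G y v -> indeg G y = 0.
Proof.
case/card_gt1P=> a [b []]; rewrite !inE => av bv ab yv.
apply/eqP/indeg0P => w; apply/negP => wy; case/eqP: ab.
by apply: (@unreached_eq w); apply: (arc_edge_unreached wy yv).
Qed.

(** A path from [y] to [s] enters [s] by an edge from some vertex [t], since no
    arc does.  Then [v] reaches [t] through [y], but also through [s], unless
    [t = v], which [v] reaches by the empty path. *)
Lemma source_unreached v s y :
  edge G v s -> indeg G s = 0 -> arc G v y -> ~~ reach k y s.
Proof.
move=> vs /eqP/indeg0P s0 vy; apply/negP => /reachP[p [mp lp sp]].
have ys : y <> s by move=> ys; rewrite -ys (arc_edgeF vy) in vs.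
case: (lastP p) mp lp sp => [|p' x] mp; first by move=> /= /ys.
rewrite last_rcons size_rcons => xs; rewrite {x}xs in mp * => sp.
have lps : edge G (last y p') s.
  case/andP: mp; rewrite rcons_path => /andP[_ /orP[//|lps]] _.
  by have := s0 (last y p'); rewrite lps.
have mv : mixed_path G v (y :: p').
  by apply: mixed_path_cons_arc vy _; apply: mixed_path_rconsK mp.
have [lv|lv] := eqVneq (last y p') v.
  have m0 : mixed_path G v [::] by [].
  by have := path_eq mv m0 sp (leq0n _) lv.
have m2 : mixed_path G v [:: s; last y p'].
  by rewrite /mixed_path /= vs (edge_sym G s) lps (negbTE lv).
by have [] := path_eq mv m2 sp (ltnW k_ge3) erefl.
Qed.

Lemma sum_indeg : \sum_x indeg G x = #|V|.
Proof.
have dE (P : rel V) x : #|[set w | P w x]| = \sum_w P w x.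
  by rewrite -sum1dep_card big_mkcond; apply: eq_bigr => w _; case: (P w x).
under eq_bigr do rewrite /indeg dE.
rewrite exchange_big /= -sum1_card; apply: eq_bigr => w _.
have [_ <-] := degrees_eq w.
by rewrite /outdeg (dE (fun a b => arc G b a)).
Qed.

(** * Total regularity *)

Lemma indeg_le1 v : indeg G v <= 1.
Proof.
rewrite leqNgt; apply/negP => v2.
have [y vy] := ex_arc v.
have [s vs] : exists s, edge G v s.
  have /card_gt0P[s] : 0 < udeg G v by apply: leq_trans (udeg_ge v).
  by rewrite inE => vs; exists s.
have s_unr t : edge G v t -> ~~ reach k y t.
  move=> vt; apply: (source_unreached vt _ vy).
  by apply: (nbr_indeg0 v2); rewrite edge_sym.
have nbr_v t : edge G v t -> t = s.
  by move=> vt; apply: (@unreached_eq y); apply: s_unr.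
have r1 : r = 1.
  have [<- _] := degrees_eq v; rewrite /udeg; apply/eqP/cards1P; exists s.
  by apply/setP => t; rewrite !inE; apply/idP/eqP => [/nbr_v|->].
have nbr1 x : exists x', forall t, edge G x t = (t == x').
  have [/eqP] := degrees_eq x; rewrite r1 => /cards1P[x' E] _; exists x' => t.
  by have /setP/(_ t) := E; rewrite !inE.
(* Each in-degree is counted twice: once at its vertex, once at the partner. *)
have sum2 : \sum_x (indeg G x + \sum_(t | edge G x t) indeg G t) = \sum_(x : V) 2.
  rewrite big_split /= (exchange_big_dep xpredT) //= sum_indeg sum_nat_const muln2.
  rewrite -addnn; congr (_ + _); rewrite -sum_indeg; apply: eq_bigr => t _.
  have [t' tE] := nbr1 t; rewrite (eq_bigl (pred1 t')) ?big_pred1_eq // => x.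
  by rewrite edge_sym tE.
have le2 x : indeg G x + \sum_(t | edge G x t) indeg G t <= 2.
  have [x' xE] := nbr1 x; rewrite (eq_bigl (pred1 x')) // big_pred1_eq.
  have xx' : edge G x x' by rewrite xE.
  have x'x : edge G x' x by rewrite edge_sym.
  have [x2|x1] := ltnP 1 (indeg G x).
    by rewrite (nbr_indeg0 x2 x'x) addn0 indeg_le2.
  have [x'2|x'1] := ltnP 1 (indeg G x').
    by rewrite (nbr_indeg0 x'2 xx') indeg_le2.
  by rewrite -[2]/(1 + 1) leq_add.
have eq2 := sum_eq_upper_bound le2 sum2.
have [w0 w0v w0unr] := unreached_in_arc v2.
have [y' yE] := nbr1 y.
have yy' : edge G y y' by rewrite yE.
have y'0 : indeg G y' = 0.
  apply/eqP/indeg0P => w; apply/negP => wy'.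
  have ww0 : w = w0.
    by apply: (unreached_eq _ w0unr); apply: (arc_edge_unreached vy yy' wy').
  rewrite ww0 in wy'; have y'v := arc_inj wy' w0v.
  by rewrite y'v edge_sym (arc_edgeF vy) in yy'.
have y2 : 1 < indeg G y.
  by have := eq2 y; rewrite (eq_bigl (pred1 y')) // big_pred1_eq y'0 addn0 => ->.
have [w wy wunr] := unreached_in_arc y2.
have ws : w = s by apply: (unreached_eq wunr); apply: s_unr.
rewrite {}ws in wy.
have m1 : mixed_path G v [:: y] by rewrite /mixed_path /= vy orbT.
have m2 : mixed_path G v [:: s; y].
  by rewrite /mixed_path /= vs wy (arc_edgeF wy) !orbT andbF.
by have := path_eq m1 m2 (ltnW (ltnW k_ge3)) (ltnW k_ge3) erefl.
Qed.

Lemma indeg_eq1 x : indeg G x = 1.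
Proof.
by apply: (sum_eq_upper_bound indeg_le1); rewrite sum_indeg sum1_card.
Qed.

End UnitExcess.
End Paths.

Theorem theorem5p5 (R : rcfType) (V : finType) (G : mixed_graph V) (r k : nat)
    (hr : 1 <= r) (hk : 4 <= k) (hG : excess_graph R r 1 k 1 G) :
  totally_regular G.
Proof.
case: hG => _ geo udeg_ge outdeg_ge; rewrite moore_bound_tree_size //.
rewrite -natrD => /eqP; rewrite eqr_nat => /eqP cardE.
have k3 := ltnW hk.
have deg := degrees_eq hr k3 geo udeg_ge outdeg_ge cardE.
split=> [u v|u].
  by have [-> ->] := deg u; have [-> ->] := deg v.
by have [_ ->] := deg u; rewrite (indeg_eq1 hr k3 geo udeg_ge outdeg_ge cardE).
Qed.
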